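(* Let $\alpha$ (with structure map $\varphi:H^{(0)}\to G^{(0)}$) be a regular action of a groupoid $G$ on a small category $H$. Let $C^{*}(H)$ be generated by its universal family of partial isometries $\{S_{h}\}_{h\in H}$. (a) For every $g\in G$, the $C^*$-algebra $C^*(H^g)=C^*(H^{\mathbf{s}(g)})$ can be identified with the closed $*$-subalgebra of $C^*(H)$ generated by $\{S_h\}_{h\in H^g}$ (that is, if $\{T_h\}_{h\in H^g}$ is the universal generating family of $C^*(H^g)$, then $T_h\mapsto S_h$ extends to a $*$-isomorphism of $C^*(H^g)$ onto this subalgebra). (b) There exists a quasi action $\tilde\alpha$ of $G$ on $C^*(H)$ such that for any $g\in G$, with the identification in (a), the restriction $\tilde{\alpha}_g|_{C^*(H^{\mathbf{s}(g)})}:C^*(H^{\mathbf{s}(g)})\to C^*(H^{\mathbf{t}(g)})$ is the $*$-isomorphism given by $\tilde{\alpha}_g(S_h)=S_{\alpha_g(h)}$ for $h\in H^g$. In this way one obtains a quasi $C^*$-dynamical system $(C^*(H),G,\tilde\alpha)$.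
   Context: **Small categories.** A small category $\Lambda$ is identified with its set of morphisms; objects are identified with identity morphisms, and $\Lambda^{(0)}$ denotes the set of objects. $\mathbf{s},\mathbf{t}$ are the source and target maps; $(f,g)\in\Lambda^{(2)}$ (composable, with product $fg$) iff $\mathbf{s}(f)=\mathbf{t}(g)$. A groupoid is a small category in which all morphisms are invertible (no topology; groupoids are discrete). For $f,g\in\Lambda$, $f$ and $g$ intersect if they have a common multiple, i.e. $fh=gk$ for some $h,k\in\Lambda$; otherwise they are disjoint, written $f\perp g$. **Action.** Let $G,H$ be small categories and $\varphi:H^{(0)}\to G^{(0)}$ a map (always assumed surjective). Put $G\times^\varphi H=\{(g,h)\in G\times H:\mathbf{s}(g)=\varphi(\mathbf{t}(h))=\varphi(\mathbf{s}(h))\}$. A left action $(\varphi,\alpha)$ (or just $\alpha$) of $G$ on $H$ is a map $(g,h)\mapsto\alpha_g(h)$ from $G\times^\varphi H$ to $H$ such that for any $(g',g)\in G^{(2)}$, $(h',h)\in H^{(2)}$, $u\in H^{(0)}$ with $(g,h),(g,u),(g,h')\in G\times^\varphi H$: $\alpha_g(\mathbf{s}(h))=\mathbf{s}(\alpha_g(h))$; $\alpha_g(\mathbf{t}(h))=\mathbf{t}(\alpha_g(h))$; $\varphi(\alpha_g(u))=\mathbf{t}(g)$; $\alpha_{\varphi(\mathbf{t}(h))}(h)=h$; $\alpha_{g'}(\alpha_g(h))=\alpha_{g'g}(h)$; $\alpha_g(h'h)=\alpha_g(h')\alpha_g(h)$. For $g\in G$, $H^g=\{h\in H:\mathbf{s}(g)=\varphi(\mathbf{s}(h))=\varphi(\mathbf{t}(h))\}$,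 a subcategory of $H$. The action is regular if $\varphi(\mathbf{s}(h))=\varphi(\mathbf{t}(h))$ for all $h\in H$. **$C^*$-algebra of a small category.** A representation of $\Lambda$ in a unital $C^*$-algebra $B$ is a map $S:\Lambda\to B$, $f\mapsto S_f$, such that: each $S_f$ is a partial isometry; $S_fS_g=S_{fg}$ if $(f,g)\in\Lambda^{(2)}$ and $S_fS_g=0$ otherwise; the projections $Q_f=S_f^*S_f$ and $P_g=S_gS_g^*$ ($f,g\in\Lambda$) all commute with each other; $P_fP_g=0$ if $f\perp g$; $Q_fP_g=P_g$ if $(f,g)\in\Lambda^{(2)}$. $C^*(\Lambda)$ is the universal $C^*$-algebra generated by partial isometries $\{S_f\}_{f\in\Lambda}$ subject to $f\mapsto S_f$ being a representation: for every representation $T$ of $\Lambda$ in a unital $C^*$-algebra $B$ there is a unique $*$-homomorphism $C^*(\Lambda)\to B$ sending $S_f$ to $T_f$ for all $f$. **Quasi action.** For a $C^*$-algebra $A$, $\mathcal{N}(A)$ is the set of pairs $(\psi,\mathcal{D}(\psi))$ where $\psi:A\to A$ is a $*$-homomorphism, $\mathcal{D}(\psi)\subseteq A$ is a closed $*$-subalgebra, and $\psi|_{\mathcal{D}(\psi)}:\mathcal{D}(\psi)\to\psi(A)$ is a $*$-isomorphism. A quasi action of a groupoid $G$ on $A$ is a map $\beta:G\to\mathcal{N}(A)$ such that if $(s,t)\in G^{(2)}$ then $\beta_t(A)=\mathcal{D}(\beta_s)$, $\mathcal{D}(\beta_{st})=\mathcal{D}(\beta_t)$ and $\beta_{st}=\beta_s\beta_t$;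 and if $(s,t)\notin G^{(2)}$ then $\beta_s\beta_t=0$. Then $(A,G,\beta)$ is called a quasi $C^*$-dynamical system. *)

(* Defs.v *)
From HB Require Import structures.
From mathcomp Require Import all_boot all_order all_algebra complex.
From mathcomp Require Import all_classical all_reals all_analysis.

Set Implicit Arguments.
Unset Strict Implicit.
Unset Printing Implicit Defensive.

Import Order.TTheory GRing.Theory Num.Theory numFieldNormedType.Exports.
Local Open Scope classical_set_scope.
Local Open Scope ring_scope.

(** A small category is identified with its set of morphisms, and its objects
    with the identity morphisms. [comp f g] stands for the product [fg]; it is
    only meaningful when [src f = tgt g], and is an arbitrary morphism
    otherwise. *)
Record smallCat := SmallCat {
  mor :> Type;
  src : mor -> mor;
  tgt : mor -> mor;
  comp : mor -> mor -> mor;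
  src_src : forall f, src (src f) = src f;
  tgt_src : forall f, tgt (src f) = src f;
  src_tgt : forall f, src (tgt f) = tgt f;
  tgt_tgt : forall f, tgt (tgt f) = tgt f;
  src_comp : forall f g, src f = tgt g -> src (comp f g) = src g;
  tgt_comp : forall f g, src f = tgt g -> tgt (comp f g) = tgt f;
  comp_src : forall f, comp f (src f) = f;
  comp_tgt : forall f, comp (tgt f) f = f;
  comp_assoc : forall f g h, src f = tgt g -> src g = tgt h ->
    comp f (comp g h) = comp (comp f g) h
}.

Arguments src {s} _.
Arguments tgt {s} _.
Arguments comp {s} _ _.

Definition objects (L : smallCat) : set L := [set u | src u = u].

Arguments objects L : clear implicits.

Definition composable (L : smallCat) (f g : L) : Prop := src f = tgt g.

Definition is_groupoid (G : smallCat) : Prop :=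
  forall g : G, exists k : G,
    [/\ composable g k, composable k g, comp g k = tgt g & comp k g = src g].

Definition intersect (L : smallCat) (f g : L) : Prop :=
  exists h k : L, [/\ composable f h, composable g k & comp f h = comp g k].

Definition disjoint_mor (L : smallCat) (f g : L) : Prop := ~ intersect f g.

Record is_subcat (L : smallCat) (P : set L) : Prop := IsSubcat {
  subcat_src : forall f, P f -> P (src f);
  subcat_tgt : forall f, P f -> P (tgt f);
  subcat_comp : forall f g, P f -> P g -> composable f g -> P (comp f g)
}.

Section Subcategory.
Variables (L : smallCat) (P : set L) (subP : is_subcat P).

Let in_set_type (x : set_type P) : P (val x) := set_mem (valP x).
Let mk (f : L) (Pf : P f) : set_type P := exist _ f (mem_set Pf).

Definition sub_src (f : set_type P) : set_type P :=
  mk (subcat_src subP (in_set_type f)).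

Definition sub_tgt (f : set_type P) : set_type P :=
  mk (subcat_tgt subP (in_set_type f)).

Definition sub_comp (f g : set_type P) : set_type P :=
  match pselect (P (comp (val f) (val g))) with
  | left Pfg => mk Pfg
  | right _ => f
  end.

Let val_comp (f g : set_type P) :
  sub_src f = sub_tgt g -> val (sub_comp f g) = comp (val f) (val g).
Proof.
move=> /(congr1 val) /= fg; rewrite /sub_comp; case: pselect => //= nP.
by case: nP; apply: subcat_comp => //; exact: in_set_type.
Qed.

Let sub_src_src f : sub_src (sub_src f) = sub_src f.
Proof. by apply: val_inj; rewrite /= src_src. Qed.

Let sub_tgt_src f : sub_tgt (sub_src f) = sub_src f.
Proof. by apply: val_inj; rewrite /= tgt_src. Qed.

Let sub_src_tgt f : sub_src (sub_tgt f) = sub_tgt f.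
Proof. by apply: val_inj; rewrite /= src_tgt. Qed.

Let sub_tgt_tgt f : sub_tgt (sub_tgt f) = sub_tgt f.
Proof. by apply: val_inj; rewrite /= tgt_tgt. Qed.

Let sub_src_comp f g :
  sub_src f = sub_tgt g -> sub_src (sub_comp f g) = sub_src g.
Proof.
move=> fg; apply: val_inj; rewrite /= val_comp// src_comp//.
exact: (congr1 val fg).
Qed.

Let sub_tgt_comp f g :
  sub_src f = sub_tgt g -> sub_tgt (sub_comp f g) = sub_tgt f.
Proof.
move=> fg; apply: val_inj; rewrite /= val_comp// tgt_comp//.
exact: (congr1 val fg).
Qed.

Let sub_comp_src f : sub_comp f (sub_src f) = f.
Proof. by apply: val_inj; rewrite val_comp ?sub_tgt_src//= comp_src. Qed.

Let sub_comp_tgt f : sub_comp (sub_tgt f) f = f.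
Proof. by apply: val_inj; rewrite val_comp ?sub_src_tgt//= comp_tgt. Qed.

Let sub_comp_assoc f g h : sub_src f = sub_tgt g -> sub_src g = sub_tgt h ->
  sub_comp f (sub_comp g h) = sub_comp (sub_comp f g) h.
Proof.
move=> fg gh; apply: val_inj.
rewrite val_comp ?sub_tgt_comp// val_comp// val_comp ?sub_src_comp//.
rewrite val_comp// comp_assoc//; [exact: (congr1 val fg)|].
exact: (congr1 val gh).
Qed.

Definition subcat : smallCat :=
  SmallCat sub_src_src sub_tgt_src sub_src_tgt sub_tgt_tgt sub_src_comp
    sub_tgt_comp sub_comp_src sub_comp_tgt sub_comp_assoc.

End Subcategory.

(** The structure map [phi] is a function on all of [H], of which only the
    values on [objects H] matter. *)
Definition act_dom (G H : smallCat) (phi : H -> G) (g : G) (h : H) : Prop :=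
  src g = phi (tgt h) /\ src g = phi (src h).

(** Likewise [alpha g h] is only meaningful when [act_dom phi g h]. *)
Record is_action (G H : smallCat) (phi : H -> G) (alpha : G -> H -> H) :
    Prop := IsAction {
  act_phi_fun : set_fun (objects H) (objects G) phi;
  act_phi_surj : set_surj (objects H) (objects G) phi;
  act_src : forall g h, act_dom phi g h -> alpha g (src h) = src (alpha g h);
  act_tgt : forall g h, act_dom phi g h -> alpha g (tgt h) = tgt (alpha g h);
  act_phi : forall g u, objects H u -> act_dom phi g u ->
    phi (alpha g u) = tgt g;
  act_id : forall g h, act_dom phi g h -> alpha (phi (tgt h)) h = h;
  act_comp : forall g' g h, composable g' g -> act_dom phi g h ->
    alpha g' (alpha g h) = alpha (comp g' g) h;
  act_mul : forall g h' h, composable h' h ->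
    act_dom phi g h -> act_dom phi g h' ->
    alpha g (comp h' h) = comp (alpha g h') (alpha g h)
}.

Definition regular (G H : smallCat) (phi : H -> G) : Prop :=
  forall h : H, phi (src h) = phi (tgt h).

(** The subcategory written $H^g$. *)
Definition fiber (G H : smallCat) (phi : H -> G) (g : G) : set H :=
  [set h | src g = phi (src h) /\ src g = phi (tgt h)].

Lemma fiber_is_subcat (G H : smallCat) (phi : H -> G) (g : G) :
  is_subcat (fiber phi g).
Proof.
split=> [f [? ?]|f [? ?]|f k [? ?] [? ?] fk]; rewrite /fiber /=.
- by rewrite src_src tgt_src.
- by rewrite src_tgt tgt_tgt.
- by rewrite src_comp// tgt_comp.
Qed.

Definition fiber_cat (G H : smallCat) (phi : H -> G) (g : G) : smallCat :=
  subcat (fiber_is_subcat phi g).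

Record cstarAlgebra (R : realType) := CStarAlgebra {
  cstar_carrier :> completeNormedModType R[i];
  cmul : cstar_carrier -> cstar_carrier -> cstar_carrier;
  cstar : cstar_carrier -> cstar_carrier;
  cmulA : forall x y z, cmul x (cmul y z) = cmul (cmul x y) z;
  cmul_linearl : forall (a : R[i]) x y z,
    cmul (a *: x + y) z = a *: cmul x z + cmul y z;
  cmul_linearr : forall (a : R[i]) x y z,
    cmul x (a *: y + z) = a *: cmul x y + cmul x z;
  cstarK : forall x, cstar (cstar x) = x;
  cstar_antilinear : forall (a : R[i]) x y,
    cstar (a *: x + y) = Num.conj a *: cstar x + cstar y;
  cstarM : forall x y, cstar (cmul x y) = cmul (cstar y) (cstar x);
  cnormM : forall x y, `|cmul x y| <= `|x| * `|y|;
  cnorm_star : forall x, `|cmul (cstar x) x| = `|x| ^+ 2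
}.

Arguments cmul {R c} _ _.
Arguments cstar {R c} _.

Section CStar.
Variable R : realType.
Implicit Types A B : cstarAlgebra R.

Definition unital A : Prop :=
  exists e : A, forall x : A, cmul e x = x /\ cmul x e = x.

Definition star_hom A B (f : A -> B) : Prop :=
  [/\ linear f, {morph f : x y / cmul x y} & {morph f : x / cstar x}].

Record closed_star_subalg A (D : set A) : Prop := ClosedStarSubalg {
  subalg_closed_top : closed D;
  subalg_zero : D 0;
  subalg_linear : forall (a : R[i]) x y, D x -> D y -> D (a *: x + y);
  subalg_mul : forall x y, D x -> D y -> D (cmul x y);
  subalg_star : forall x, D x -> D (cstar x)
}.

Definition cstar_gen A (X : set A) : set A := smallest (@closed_star_subalg A) X.

(** The *-homomorphism [f] restricts to a *-isomorphism of the *-subalgebra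
    [D] onto the *-subalgebra [E]. *)
Definition star_iso_on A B (D : set A) (E : set B) (f : A -> B) : Prop :=
  star_hom f /\ set_bij D E f.

Definition partial_isometry A (x : A) : Prop := cmul (cmul x (cstar x)) x = x.

Definition initial_proj A (x : A) : A := cmul (cstar x) x.
Definition final_proj A (x : A) : A := cmul x (cstar x).

Definition commuting A (x y : A) : Prop := cmul x y = cmul y x.

(** [A] need not be unital here, so that the generating family of a universal
    C*-algebra can itself be called a representation. *)
Record representation (L : smallCat) A (S : L -> A) : Prop := Representation {
  rep_pisom : forall f, partial_isometry (S f);
  rep_mul : forall f g, composable f g -> cmul (S f) (S g) = S (comp f g);
  rep_mul0 : forall f g, ~ composable f g -> cmul (S f) (S g) = 0;
  rep_commQQ : forall f g, commuting (initial_proj (S f)) (initial_proj (S g));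
  rep_commQP : forall f g, commuting (initial_proj (S f)) (final_proj (S g));
  rep_commPP : forall f g, commuting (final_proj (S f)) (final_proj (S g));
  rep_disjoint : forall f g, disjoint_mor f g ->
    cmul (final_proj (S f)) (final_proj (S g)) = 0;
  rep_QP : forall f g, composable f g ->
    cmul (initial_proj (S f)) (final_proj (S g)) = final_proj (S g)
}.

Record is_cstar_of_cat (L : smallCat) A (S : L -> A) : Prop := IsCStarOfCat {
  univ_rep : representation S;
  univ_gen : cstar_gen (range S) = setT;
  univ_property : forall B, unital B ->
    forall T : L -> B, representation T ->
    exists! p : A -> B, star_hom p /\ forall f, p (S f) = T f
}.

(** The set written $\mathcal{N}(A)$. *)
Record partialEndo A := PartialEndo {
  pendo_fun :> A -> A;
  pendo_dom : set A;
  pendo_hom : star_hom pendo_fun;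
  pendo_dom_subalg : closed_star_subalg pendo_dom;
  pendo_iso : star_iso_on pendo_dom (range pendo_fun) pendo_fun
}.

Record quasi_action A (G : smallCat) (beta : G -> partialEndo A) : Prop :=
    QuasiAction {
  qact_range : forall s t, composable s t ->
    range (beta t) = pendo_dom (beta s);
  qact_dom : forall s t, composable s t ->
    pendo_dom (beta (comp s t)) = pendo_dom (beta t);
  qact_comp : forall s t, composable s t ->
    forall x, beta (comp s t) x = beta s (beta t x);
  qact_zero : forall s t, ~ composable s t -> forall x, beta s (beta t x) = 0
}.

Definition quasi_dynamical_system A (G : smallCat)
    (beta : G -> partialEndo A) : Prop :=
  is_groupoid G /\ quasi_action beta.

End CStar.

(* Main.v *)
Require Import Defs.
From HB Require Import structures.
From mathcomp Require Import all_boot all_order all_algebra complex.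
From mathcomp Require Import all_classical all_reals all_analysis.
From mathcomp Require Import ring lra.
Set Implicit Arguments.
Unset Strict Implicit.
Unset Printing Implicit Defensive.
Import Order.TTheory GRing.Theory Num.Theory numFieldNormedType.Exports.
Local Open Scope classical_set_scope.
Local Open Scope ring_scope.

(* If [f] and [k] are composable, they have the same [phi]-colour, so [H] is the
   disjoint union of its fibers. Hence extending a representation of a fiber by
   zero, restricting a representation of [H] to a fiber, and transporting along
   [alpha g] all give representations, and the universal properties turn them
   into *-homomorphisms; relations between those are checked on generators.
   Extension by zero is a left inverse of the map from the algebra of a fiber
   into that of [H], which is therefore isometric.

   Two facts are needed to run this. First, *-homomorphisms are contractive: if
   [a] is self-adjoint with [|a| < 1], choose a self-adjoint [c] commuting with
   [a] such that [a ^ 2 + c ^ 2 = 1]; then the images [y], [w] of [a], [c] make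
   [y + i w] unitary, so [|y| <= 1]. Second, the universal property only
   concerns unital algebras, whereas the algebra of [H] may have no unit: representations
   are first pushed into the multiplier algebra, built here as the algebra of
   bounded adjointable maps. *)

(** * Real-valued norms and completeness *)

Section ReNorm.
Variable R : realType.
Implicit Type a : R[i].

Lemma Re_normE a : (complex.Re `|a|)%:C%C = `|a|.
Proof. by rewrite RRe_real// ger0_real. Qed.

Lemma Re_norm_ge0 a : 0 <= complex.Re `|a|.
Proof. by rewrite -ler0c Re_normE. Qed.

End ReNorm.

Section RealNorm.
Variables (R : realType) (V : normedModType R[i]).
Implicit Types (x y : V) (e : R) (F : set_system V).

(** Norms over [R[i]] take values in [R[i]], whose order is only partial; the real part moves every
    estimate to the ordered field [R]. *)
Definition nrm x : R := complex.Re `|x|.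

Lemma nrmE x : `|x| = (nrm x)%:C%C.
Proof. by rewrite /nrm RRe_real// ger0_real. Qed.

Lemma nrm_ge0 x : 0 <= nrm x.
Proof. by rewrite -ler0c -nrmE. Qed.

Lemma nrm0 : nrm 0 = 0.
Proof. by rewrite /nrm normr0. Qed.

Lemma nrm_eq0 x : nrm x = 0 -> x = 0.
Proof. by move=> x0; apply/normr0_eq0; rewrite nrmE x0. Qed.

Lemma ler_nrmD x y : nrm (x + y) <= nrm x + nrm y.
Proof. by rewrite -lecR rmorphD/= -!nrmE ler_normD. Qed.

Lemma nrmN x : nrm (- x) = nrm x.
Proof. by rewrite /nrm normrN. Qed.

Lemma nrmB x y : nrm (x - y) = nrm (y - x).
Proof. by rewrite -nrmN opprB. Qed.

Lemma ler_nrm_dist x y z : nrm (x - z) <= nrm (x - y) + nrm (y - z).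
Proof. by rewrite -[x - z](subrKA y) ler_nrmD. Qed.

Lemma nrmZ (a : R[i]) x : nrm (a *: x) = complex.Re `|a| * nrm x.
Proof.
by apply: complexI; rewrite -nrmE normrZ rmorphM/= RRe_real ?ger0_real// -nrmE.
Qed.

Lemma nrmZr (a : R) x : 0 <= a -> nrm (a%:C%C *: x) = a * nrm x.
Proof. by move=> a0; rewrite nrmZ ger0_norm// ler0c. Qed.

(** A positive [e : R[i]] is real, hence the image of a positive element of [R]; so real radii
    suffice, here and in the two lemmas that follow. *)
Lemma cvg_nrmP F (FF : Filter F) x :
  F --> x <-> forall e, 0 < e -> \forall y \near F, nrm (x - y) < e.
Proof.
split=> [/cvgrPdist_lt Fx e e0|Fx].
  have := Fx e%:C%C; rewrite ltcR => /(_ e0); apply: filterS => y.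
  by rewrite nrmE ltcR.
apply/cvgrPdist_lt => e e0.
have eE : e = (complex.Re e)%:C%C by rewrite RRe_real// gtr0_real.
rewrite eE ltcR in e0; apply: filterS (Fx _ e0) => y.
by rewrite nrmE eE ltcR.
Qed.

Lemma cauchy_nrmP F (FF : ProperFilter F) :
  cauchy F <-> forall e, 0 < e -> exists x, \forall y \near F, nrm (x - y) < e.
Proof.
split=> [/cauchyP Fx e e0|Fx].
  have [|x xe] := Fx e%:C%C; first by rewrite ltcR.
  exists x; apply: filterS xe => y.
  by rewrite -ball_normE /= nrmE ltcR.
apply/cauchyP => e e0.
have eE : e = (complex.Re e)%:C%C by rewrite RRe_real// gtr0_real.
rewrite eE ltcR in e0; have [x xe] := Fx _ e0; exists x; apply: filterS xe => y.
by rewrite -ball_normE /= nrmE eE ltcR.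
Qed.

Lemma closed_nrmP (D : set V) :
  closed D <-> forall x, (forall e, 0 < e -> exists2 y, D y & nrm (x - y) < e) -> D x.
Proof.
split=> [cD x xD|xD].
  apply: cD => B /nbhs_normP[e /= e0 eB].
  have eE : e = (complex.Re e)%:C%C by rewrite RRe_real// gtr0_real.
  rewrite eE ltcR in e0; have [y Dy xy] := xD _ e0; exists y; split => //.
  by apply: eB; rewrite /= nrmE eE ltcR.
move=> x clDx; apply: xD => e e0.
have [|y [Dy xy]] := clDx (ball x e%:C%C).
  by apply: nbhsx_ballx; rewrite ltcR.
by exists y => //; move: xy; rewrite -ball_normE /= nrmE ltcR.
Qed.

End RealNorm.

Section Lipschitz.
Variables (R : realType) (V W : normedModType R[i]).
Implicit Types (f g : V -> W) (c : R).

Lemma closed_preimage_lipschitz f c (D : set W) :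
  (forall x y, nrm (f x - f y) <= c * nrm (x - y)) -> closed D ->
  closed (f @^-1` D).
Proof.
move=> fc /closed_nrmP cD; apply/closed_nrmP => x xD; apply: cD => e e0.
(* The constant [c] may be zero or negative; [|c| + 1] is a positive bound for it. *)
have c0 : 0 < `|c| + 1 by rewrite ltr_wpDl.
have [|y Dy xy] := xD (e / (`|c| + 1)); first by rewrite divr_gt0.
exists (f y) => //; rewrite ltr_pdivlMr// in xy.
apply: le_lt_trans (fc _ _) (le_lt_trans _ xy).
by rewrite mulrC ler_wpM2l ?nrm_ge0// (le_trans (ler_norm c))// lerDl.
Qed.

Lemma closed_eq_lipschitz f g c :
  (forall x y, nrm (f x - f y) <= c * nrm (x - y)) ->
  (forall x y, nrm (g x - g y) <= c * nrm (x - y)) ->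
  closed [set x | f x = g x].
Proof.
move=> fc gc.
have -> : [set x | f x = g x] = (f \- g) @^-1` [set 0].
  by apply/seteqP; split=> x /= => [->|/subr0_eq//]; rewrite subrr.
apply: (@closed_preimage_lipschitz _ (c + c)).
  move=> x y /=; rewrite opprD addrACA -opprD mulrDl.
  by apply: le_trans (ler_nrmD _ _) _; rewrite nrmN lerD.
apply/closed_nrmP => x xe /=; apply: nrm_eq0; apply/eqP.
rewrite eq_le nrm_ge0 andbT; apply/ler_addgt0Pr => e e0.
by have [_ -> /ltW] := xe _ e0; rewrite subr0 add0r.
Qed.

End Lipschitz.

(** * Limits of sequences and Banach's fixed point theorem *)

Section Complete.
Variables (R : realType) (V : completeNormedModType R[i]).

Lemma cauchy_seq_cvg (x : nat -> V) :
  (forall e : R, 0 < e -> exists N, forall n, (N <= n)%N -> nrm (x N - x n) < e) ->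
  exists l, forall e : R, 0 < e ->
    exists N, forall n, (N <= n)%N -> nrm (l - x n) < e.
Proof.
move=> xC; have : cauchy (x @ \oo).
  apply/cauchy_nrmP => e e0; have [N xN] := xC e e0.
  by exists (x N); exists N.
move=> /cauchy_cvg /cvg_ex [l /cvg_nrmP xl]; exists l => e e0.
by have [N _ xN] := xl e e0; exists N.
Qed.

(** Preimages of a sequence tending to [w] form a Cauchy sequence in [V], and [f] maps its limit to
    [w]. *)
Lemma closed_range_isometry (W : normedModType R[i]) (f : V -> W) :
  (forall x y, nrm (f x - f y) = nrm (x - y)) -> closed (range f).
Proof.
move=> fi; apply/closed_nrmP => w wD.
have wv n : exists v, nrm (w - f v) < n.+1%:R^-1.
  have [|_ [v _ <-] ?] := wD n.+1%:R^-1; first by rewrite invr_gt0.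
  by exists v.
have [v vw] := choice wv.
have small e : 0 < e -> exists N, forall n, (N <= n)%N -> nrm (w - f (v n)) < e.
  move=> e0; have [N _ Ne] := near_infty_natSinv_lt (PosNum e0).
  by exists N => n /Ne; exact: lt_trans.
have [|l lv] := @cauchy_seq_cvg v.
  move=> e e0; have [|N Ne] := small (e / 2); first by rewrite divr_gt0.
  exists N => n Nn; rewrite -fi (splitr e).
  apply: le_lt_trans (ler_nrm_dist _ w _) _.
  by rewrite ltrD ?Ne// nrmB Ne.
exists l => //; apply/subr0_eq/nrm_eq0/eqP.
rewrite eq_le nrm_ge0 andbT; apply/ler_addgt0Pr => e e0; rewrite add0r.
have e20 : 0 < e / 2 by rewrite divr_gt0.
have [[N Ne] [M Me]] := (small _ e20, lv _ e20).
rewrite (splitr e) (le_trans (ler_nrm_dist _ (f (v (maxn N M))) _))// lerD//.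
  by rewrite fi ltW// Me// leq_maxr.
by rewrite nrmB ltW// Ne// leq_maxl.
Qed.

Lemma contraction_fixed_point (D : set V) (f : V -> V) (q : R) :
  closed D -> D !=set0 -> set_fun D D f -> 0 <= q < 1 ->
  (forall x y, D x -> D y -> nrm (f x - f y) <= q * nrm (x - y)) ->
  exists2 d, D d & f d = d.
Proof.
move=> cD [x0 Dx0] fD /andP[q0 q1] fq.
pose x n := iter n f x0; pose K := nrm (x0 - f x0) / (1 - q).
have q1' : 0 < 1 - q by rewrite subr_gt0.
have Dx n : D (x n) by elim: n => //= n; exact: fD.
have xq n m : nrm (x n - x (n + m)%N) <= q ^+ n * nrm (x0 - x m).
  elim: n => [|n IH]; first by rewrite expr0 mul1r.
  rewrite addSn /= (le_trans (fq _ _ (Dx _) (Dx _)))// exprS -mulrA.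
  by rewrite ler_wpM2l.
have xK m : nrm (x0 - x m) <= K.
  (* [K] is the sum of the geometric series with first term [|x0 - f x0|] and ratio [q]; this
     equation drives the induction bounding the distance from [x0] to every iterate. *)
  have KE : K = nrm (x0 - f x0) + q * K.
    by rewrite /K; field; rewrite gt_eqF.
  elim: m => [|m IH]; first by rewrite subrr nrm0 divr_ge0 ?nrm_ge0 ?ltW.
  rewrite KE (le_trans (ler_nrm_dist _ (x 1%N) _))// lerD//=.
  by rewrite (le_trans (fq _ _ Dx0 (Dx _)))// ler_wpM2l.
have K0 : 0 <= K by rewrite divr_ge0 ?nrm_ge0 ?ltW.
have xe e : 0 < e -> exists N, forall n, (N <= n)%N -> nrm (x N - x n) < e.
  move=> e0.
  have eK : 0 < e / (K + 1) by rewrite divr_gt0// ltr_wpDl.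
  have [] := @cvgr0_norm_lt _ _ _ _ _ (GRing.exp q) (cvg_expr _) _ eK.
    by rewrite ger0_norm.
  move=> N _ /(_ N (leqnn N)); rewrite /= ger0_norm ?exprn_ge0// => qN.
  exists N => n Nn; rewrite -(subnKC Nn) (le_lt_trans (xq _ _))//.
  rewrite ltr_pdivlMr ?ltr_wpDl// in qN; apply: le_lt_trans qN.
  rewrite ler_wpM2l ?exprn_ge0// (le_trans (xK _))// lerDl//.
have [l lx] := cauchy_seq_cvg xe.
have Dl : D l.
  apply: ((closed_nrmP D).1 cD) => e e0; have [N Ne] := lx e e0.
  by exists (x N) => //; exact: Ne.
exists l => //; apply/subr0_eq/nrm_eq0/eqP.
rewrite eq_le nrm_ge0 andbT; apply/ler_addgt0Pr => e e0; rewrite add0r.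
have [|N Ne] := lx (e / 2); first by rewrite divr_gt0.
rewrite (splitr e) (le_trans (ler_nrm_dist _ (x N.+1) _))// lerD//.
  rewrite (le_trans (fq _ _ Dl (Dx _)))//.
  rewrite (le_trans _ (ltW (Ne N _)))// ler_piMl ?nrm_ge0//.
  exact: ltW.
by rewrite nrmB ltW// Ne.
Qed.

End Complete.

(** * *-homomorphisms are contractive *)

Section CStarAlgebraTheory.
Variables (R : realType) (A : cstarAlgebra R).
Implicit Types (x y z : A) (a : R[i]).

Lemma cmulDl x y z : cmul (x + y) z = cmul x z + cmul y z.
Proof. by have := cmul_linearl 1 x y z; rewrite !scale1r. Qed.

Lemma cmulDr x y z : cmul x (y + z) = cmul x y + cmul x z.
Proof. by have := cmul_linearr 1 x y z; rewrite !scale1r. Qed.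

Lemma cmul0l x : cmul 0 x = 0.
Proof. by apply: (addrI (cmul 0 x)); rewrite -cmulDl !addr0. Qed.

Lemma cmul0r x : cmul x 0 = 0.
Proof. by apply: (addrI (cmul x 0)); rewrite -cmulDr !addr0. Qed.

Lemma cmulZl a x y : cmul (a *: x) y = a *: cmul x y.
Proof. by have := cmul_linearl a x 0 y; rewrite cmul0l !addr0. Qed.

Lemma cmulZr a x y : cmul x (a *: y) = a *: cmul x y.
Proof. by have := cmul_linearr a x y 0; rewrite cmul0r !addr0. Qed.

Lemma cmulNl x y : cmul (- x) y = - cmul x y.
Proof. by rewrite -scaleN1r cmulZl scaleN1r. Qed.

Lemma cmulNr x y : cmul x (- y) = - cmul x y.
Proof. by rewrite -scaleN1r cmulZr scaleN1r. Qed.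

Lemma cmulBl x y z : cmul (x - y) z = cmul x z - cmul y z.
Proof. by rewrite cmulDl cmulNl. Qed.

Lemma cmulBr x y z : cmul x (y - z) = cmul x y - cmul x z.
Proof. by rewrite cmulDr cmulNr. Qed.

Lemma cstarD x y : cstar (x + y) = cstar x + cstar y.
Proof. by have := cstar_antilinear 1 x y; rewrite rmorph1 !scale1r. Qed.

Lemma cstar0 : cstar (0 : A) = 0.
Proof. by apply: (addrI (cstar 0)); rewrite -cstarD !addr0. Qed.

Lemma cstarZ a x : cstar (a *: x) = Num.conj a *: cstar x.
Proof. by have := cstar_antilinear a x 0; rewrite cstar0 !addr0. Qed.

Lemma cstarN x : cstar (- x) = - cstar x.
Proof. by rewrite -scaleN1r cstarZ rmorphN rmorph1 scaleN1r. Qed.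

Lemma cstarB x y : cstar (x - y) = cstar x - cstar y.
Proof. by rewrite cstarD cstarN. Qed.

Lemma cstarZr (r : R) x : cstar (r%:C%C *: x) = r%:C%C *: cstar x.
Proof. by rewrite cstarZ conj_Creal//; apply/complex_realP; exists r. Qed.

Lemma nrm_cmul x y : nrm (cmul x y) <= nrm x * nrm y.
Proof. by rewrite -lecR rmorphM/= -!nrmE cnormM. Qed.

Lemma nrm_cstar_mul x : nrm (cmul (cstar x) x) = nrm x ^+ 2.
Proof. by apply: complexI; rewrite rmorphXn/= -!nrmE cnorm_star. Qed.

(** Dividing [|y|^2 = |y* y| <= |y*| |y|] by [|y|] gives one inequality; replacing [y] by its
    adjoint gives the other. *)
Lemma nrm_cstar x : nrm (cstar x) = nrm x.
Proof.
suff le_star y : nrm y <= nrm (cstar y).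
  by apply: le_anti; rewrite le_star andbT -{2}[x]cstarK le_star.
have [-> |] := eqVneq (nrm y) 0; first exact: nrm_ge0.
rewrite neq_lt ltNge nrm_ge0/= => y0.
by rewrite -(ler_pM2r y0) -expr2 -nrm_cstar_mul nrm_cmul.
Qed.

Lemma cstar_mul_eq0 x : cmul (cstar x) x = 0 -> x = 0.
Proof.
move=> xx0; apply: nrm_eq0; apply/eqP; rewrite -sqrf_eq0 -nrm_cstar_mul.
by rewrite xx0 nrm0.
Qed.

End CStarAlgebraTheory.

Section StarHomContractive.
Variables (R : realType).
Implicit Types A B : cstarAlgebra R.

(* For [|a| < 1] the element [d] is [1 - sqrt (1 - a ^ 2)]. *)
Lemma half_circle A (a : A) : cstar a = a -> nrm a < 1 ->
  exists d : A, [/\ cstar d = d, cmul a d = cmul d a &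
    cmul a a = d + d - cmul d d].
Proof.
move=> as_a a1; pose q := nrm a ^+ 2.
have q01 : 0 <= q < 1.
  by rewrite exprn_ge0 ?nrm_ge0//= expr_lt1// nrm_ge0.
have /andP[q0 q1] := q01.
(* A fixed point of [f] solves [2 d = a^2 + d^2], which is the required relation. The bound
   [q = |a|^2] on the norms in [D] makes [f] a [q]-contraction of [D] into itself. *)
pose D := [set d : A | cstar d = d] `&` [set d | cmul a d = cmul d a]
  `&` [set d | nrm d <= q].
pose f (d : A) : A := (2^-1)%:C%C *: (cmul a a + cmul d d).
have [|||||d [[ds ad] _] fd] := @contraction_fixed_point _ _ D f q.
- apply: closedI; [apply: closedI|].
  + apply: (@closed_eq_lipschitz _ _ _ _ _ 1) => x y; rewrite mul1r//.
    by rewrite -cstarB nrm_cstar.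
  + apply: (@closed_eq_lipschitz _ _ _ _ _ (nrm a)) => x y.
      by rewrite -cmulBr nrm_cmul.
    by rewrite -cmulBl mulrC nrm_cmul.
  + apply/closed_nrmP => x xe /=; apply/ler_addgt0Pr => e e0.
    have [y /= yq xy] := xe _ e0.
    by have := ler_nrmD y (x - y); rewrite addrC subrK; lra.
- by exists 0; split=> /=; [split|]; rewrite ?cstar0 ?cmul0r ?cmul0l ?nrm0.
- move=> x [[xs ax] xq]; rewrite /f; split=> /=; [split=> /=|].
  + by rewrite cstarZr cstarD !cstarM as_a xs.
  + by rewrite cmulZl cmulZr cmulDl cmulDr !cmulA ax -[cmul (cmul x a) x]cmulA ax cmulA.
  + rewrite nrmZr ?invr_ge0// ler_pdivrMl//.
    rewrite (le_trans (ler_nrmD _ _))// mulrDl !mul1r lerD//.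
      by rewrite (le_trans (nrm_cmul _ _)).
    rewrite (le_trans (nrm_cmul _ _))// (le_trans (ler_pM _ _ xq xq)) ?nrm_ge0//.
    by rewrite ler_piMl// ltW.
- by [].
- move=> x y [[_ _] xq] [[_ _] yq].
  rewrite /f -scalerBr nrmZr ?invr_ge0// ler_pdivrMl//.
  (* This factorization of [x^2 - y^2] does not require [x] and [y] to commute. *)
  have -> : cmul a a + cmul x x - (cmul a a + cmul y y) =
    cmul x (x - y) + cmul (x - y) y.
    by rewrite opprD addrACA subrr add0r cmulBr cmulBl subrKA.
  rewrite (le_trans (ler_nrmD _ _))//.
  rewrite mulr_natl mulr2n lerD// (le_trans (nrm_cmul _ _))//.
    by rewrite ler_wpM2r ?nrm_ge0.
  by rewrite mulrC ler_wpM2r ?nrm_ge0.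
exists d; split => //.
have -> : d + d = (1 + 1) *: f d by rewrite fd scalerDl scale1r.
have -> : 1 + 1 = 2%:C%C :> R[i] by rewrite rmorph_nat.
by rewrite scalerA -rmorphM/= divff// scale1r addrK.
Qed.

(* [y ^ 2] is the mean of [u i] and [u (-i)], the products of [y] with the
   unitaries [y + i (1 - w)] and [y - i (1 - w)]. *)
Lemma nrm_le1_half_circle A (y w : A) : cstar y = y -> cstar w = w ->
  cmul y w = cmul w y -> cmul y y = w + w - cmul w w -> nrm y <= 1.
Proof.
move=> ys ws yw yyE.
pose u (e : R[i]) := cmul y y + e *: (y - cmul w y).
(* Put [v = y + e (1 - w)], so that [u e = v y]. As [y^2 + (1 - w)^2 = 1], [v] is unitary and
   [(u e)* (u e) = y^2]. Since [A] may have no unit, this is computed with [r = (1 - w) y] and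
   [r' = y (1 - w)]: the cross terms cancel by [pr], and [ppE] with [rrE] gives [p p + r' r = p]. *)
have uE (e : R[i]) : Num.conj e = - e -> e * e = -1 -> nrm (u e) = nrm y.
  move=> eN ee; apply/eqP; rewrite -(@eqrXn2 _ 2)// ?nrm_ge0//.
  rewrite -!nrm_cstar_mul; apply/eqP; congr nrm.
  rewrite /u cstarD cstarZ cstarB !cstarM ys ws eN.
  set p := cmul y y; set r := y - cmul w y; set r' := y - cmul y w.
  have pr : cmul p r = cmul r' p.
    rewrite /p /r /r' cmulBl cmulBr !cmulA.
    by congr (_ - cmul _ y); rewrite -cmulA {1}yw cmulA.
  have ppE : cmul p p = cmul (cmul y w) y + (cmul (cmul y w) y
      - cmul (cmul (cmul y w) w) y).
    rewrite /p cmulA -[cmul (cmul y y) y]cmulA.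
    by rewrite yyE cmulBr cmulDr cmulBl cmulDl !cmulA addrA.
  have rrE : cmul r' r = p - cmul (cmul y w) y - (cmul (cmul y w) y
      - cmul (cmul (cmul y w) w) y).
    by rewrite /r /r' cmulBl !cmulBr !cmulA.
  rewrite cmulDl !cmulDr !cmulZl !cmulZr pr scalerA mulNr ee opprK scale1r.
  rewrite scaleNr addrA addrK ppE rrE addrC.
  by rewrite addrACA subrK addNr addr0.
(* The sum of these two elements is [2 y^2], so [2 |y|^2 <= 2 |y|]. *)
have := ler_nrmD (u 'i) (u (- 'i)).
rewrite !uE; last 4 first.
- by rewrite rmorphN/= conjCi.
- by rewrite mulrNN -expr2 sqrCi.
- by rewrite conjCi.
- by rewrite -expr2 sqrCi.
rewrite /u addrACA scaleNr subrr addr0 -{1}ys.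
have -> : cmul (cstar y) y + cmul y y = 2%:C%C *: cmul (cstar y) y.
  by rewrite ys rmorph_nat scaler_nat mulr2n.
rewrite nrmZr// nrm_cstar_mul.
have := nrm_ge0 y; nra.
Qed.

(** On self-adjoint elements of the open unit ball, [f] preserves the relation given by
    [half_circle]. Scaling extends the bound to all self-adjoint elements, and the C*-identity,
    applied to [x* x], to all [x]. *)
Lemma star_hom_nrm A B (f : A -> B) (x : A) : star_hom f -> nrm (f x) <= nrm x.
Proof.
move=> [flin fM fstar].
have f0 : f 0 = 0 by have := flin (-1) 0 0; rewrite !scaleN1r !addNr.
have fD (y z : A) : f (y + z) = f y + f z by have := flin 1 y z; rewrite !scale1r.
have fZ (c : R[i]) (y : A) : f (c *: y) = c *: f y.
  by have := flin c y 0; rewrite f0 !addr0.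
have fN (y : A) : f (- y) = - f y by rewrite -scaleN1r fZ scaleN1r.
have unit_ball (a : A) : cstar a = a -> nrm a < 1 -> nrm (f a) <= 1.
  move=> as_a a1; have [d [ds ad aaE]] := half_circle as_a a1.
  apply: (@nrm_le1_half_circle _ _ (f d)); rewrite -?fstar ?as_a ?ds//.
    by rewrite -!fM ad.
  by rewrite -!fM aaE !fD fN fM.
have self_adjoint (a : A) : cstar a = a -> nrm (f a) <= nrm a.
  move=> as_a; apply/ler_addgt0Pr => e e0; have a0 := nrm_ge0 a.
  have t0 : 0 < nrm a + e by lra.
  have t0' : 0 <= (nrm a + e)^-1 by rewrite invr_ge0 ltW.
  (* The extra [e] makes the scaled norm strictly less than 1 and covers [a = 0]. *)
  have := @unit_ball ((nrm a + e)^-1%:C%C *: a).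
  rewrite cstarZr as_a fZ !nrmZr // ltr_pdivrMl// ler_pdivrMl//.
  by rewrite !mulr1; apply => //; lra.
rewrite -(@ler_pXn2r _ 2)// ?nnegrE ?nrm_ge0// -!nrm_cstar_mul -fstar -fM.
by apply: self_adjoint; rewrite cstarM cstarK.
Qed.

Lemma star_hom_lipschitz A B (f : A -> B) : star_hom f ->
  forall x y, nrm (f x - f y) <= 1 * nrm (x - y).
Proof.
move=> fh x y; rewrite mul1r; have [flin _ _] := fh.
have -> : f x - f y = f (x - y).
  by have := flin (-1) y x; rewrite !scaleN1r addrC => <-; rewrite addrC.
exact: star_hom_nrm.
Qed.

End StarHomContractive.

(** * The multiplier algebra *)

Section Adjointable.
Variables (R : realType) (A : cstarAlgebra R).
Implicit Types (f g : A -> A) (x y z : A).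

(** This is adjointness for [A] as a Hilbert module over itself, with inner product [x* y]. *)
Definition adjoint f g := forall x y, cmul (cstar (f x)) y = cmul (cstar x) (g y).

Definition bounded_by (c : R) f := forall x, nrm (f x) <= c * nrm x.

Lemma adjoint_sym f g : adjoint f g -> adjoint g f.
Proof.
by move=> fg x y; rewrite -[LHS]cstarK cstarM cstarK -fg cstarM cstarK.
Qed.

Lemma cstar_mul_inj x y : (forall z, cmul (cstar z) x = cmul (cstar z) y) -> x = y.
Proof.
by move=> xy; apply/subr0_eq/cstar_mul_eq0; rewrite cmulBr xy subrr.
Qed.

Lemma adjoint_uniq f g g' : adjoint f g -> adjoint f g' -> g = g'.
Proof.
by move=> fg fg'; apply/funext => x; apply: cstar_mul_inj => z; rewrite -fg fg'.
Qed.

(** Pairing with [z] turns [z* f(x)] into [(g z)* x], which is linear in [x]. So [adjointable] need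
    not list linearity. *)
Lemma adjoint_linear f g : adjoint f g -> linear f.
Proof.
move=> /adjoint_sym gf a x y; apply: cstar_mul_inj => z.
by rewrite -gf !cmulDr !cmulZr -!gf.
Qed.

Lemma adjoint_id : adjoint id id.
Proof. by []. Qed.

Lemma adjoint0 : adjoint (cst 0) (cst 0).
Proof. by move=> x y /=; rewrite cstar0 cmul0l cmul0r. Qed.

Lemma adjointZD (a : R[i]) f f' g g' : adjoint f f' -> adjoint g g' ->
  adjoint (fun x => a *: f x + g x) (fun x => Num.conj a *: f' x + g' x).
Proof.
by move=> ff gg x y; rewrite cstarD cstarZ cmulDl cmulDr cmulZl cmulZr ff gg.
Qed.

Lemma adjoint_comp f f' g g' : adjoint f f' -> adjoint g g' ->
  adjoint (f \o g) (g' \o f').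
Proof. by move=> ff gg x y /=; rewrite ff gg. Qed.

(** Divide [|g x|^2 = |x* f(g x)| <= |x| c |g x|] by [|g x|]. *)
Lemma bounded_by_adjoint c f g : adjoint f g -> bounded_by c f -> bounded_by c g.
Proof.
move=> fg fc x; have [-> |] := eqVneq (nrm (g x)) 0.
  by rewrite (le_trans (nrm_ge0 (f x))).
rewrite neq_lt ltNge nrm_ge0/= => gx0.
rewrite -(ler_pM2r gx0) -expr2 -nrm_cstar_mul (adjoint_sym fg).
by rewrite (le_trans (nrm_cmul _ _))// nrm_cstar mulrC mulrAC ler_wpM2r ?nrm_ge0.
Qed.

(** A boolean predicate on the module [A -> A], so that the multipliers inherit a submodule
    structure. *)
Definition adjointable : {pred A -> A} :=
  [pred f | `[< (exists g, adjoint f g) /\ exists c, bounded_by c f >] ].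

Lemma adjointableP f :
  reflect ((exists g, adjoint f g) /\ exists c, bounded_by c f)
    (f \in adjointable).
Proof. exact: asboolP. Qed.

Lemma adjointable_submod_closed : submod_closed adjointable.
Proof.
split; first by apply/adjointableP; split; [exists (cst 0); exact: adjoint0|];
  exists 0 => x; rewrite nrm0 mul0r.
move=> a f g /adjointableP[[f' ff'] [c fc]] /adjointableP[[g' gg'] [d gd]].
apply/adjointableP; split; first by eexists; exact: adjointZD ff' gg'.
exists (complex.Re `|a| * c + d) => x; rewrite (le_trans (ler_nrmD _ _))//.
rewrite mulrDl lerD// nrmZ -mulrA ler_wpM2l//.
by rewrite -ler0c RRe_real ?ger0_real.
Qed.

HB.instance Definition _ :=
  GRing.isSubmodClosed.Build R[i] (A -> A) adjointable adjointable_submod_closed.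

End Adjointable.

Record multiplier (R : realType) (A : cstarAlgebra R) :=
  Multiplier { mult_fun :> A -> A; mult_funP : mult_fun \in @adjointable R A }.

HB.instance Definition _ (R : realType) (A : cstarAlgebra R) :=
  [isSub of multiplier A for @mult_fun R A].
HB.instance Definition _ (R : realType) (A : cstarAlgebra R) :=
  gen_eqMixin (multiplier A).
HB.instance Definition _ (R : realType) (A : cstarAlgebra R) :=
  gen_choiceMixin (multiplier A).
HB.instance Definition _ (R : realType) (A : cstarAlgebra R) :=
  [SubChoice_isSubLmodule of multiplier A by <:].

Section OperatorNorm.
Variables (R : realType) (A : cstarAlgebra R).
Implicit Types (m : multiplier A) (x : A) (c : R).

Lemma mult_adjoint m : exists g, adjoint m g.
Proof. by have /adjointableP[] := mult_funP m. Qed.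

Lemma mult_bounded m : exists c, bounded_by c m.
Proof. by have /adjointableP[] := mult_funP m. Qed.

Lemma mult_inj m m' : (forall x, m x = m' x) -> m = m'.
Proof. by move=> mm; apply: val_inj; apply/funext. Qed.

Definition opnorm m : R := inf [set c | 0 <= c /\ bounded_by c m].

Lemma opnorm_has_inf m : has_inf [set c | 0 <= c /\ bounded_by c m].
Proof.
split; last by exists 0 => c [].
have [c mc] := mult_bounded m; exists `|c|; split=> // x.
by rewrite (le_trans (mc x))// ler_wpM2r ?nrm_ge0// ler_norm.
Qed.

Lemma opnorm_ge0 m : 0 <= opnorm m.
Proof. by apply: lb_le_inf => [|c []//]; have [] := opnorm_has_inf m. Qed.

Lemma opnorm_le m c : 0 <= c -> bounded_by c m -> opnorm m <= c.
Proof. by move=> c0 mc; apply: ge_inf => //; have [] := opnorm_has_inf m. Qed.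

Lemma opnormP m : bounded_by (opnorm m) m.
Proof.
move=> x; have [x0 | ] := eqVneq (nrm x) 0.
  by have [c /(_ x)] := mult_bounded m; rewrite x0 !mulr0.
rewrite neq_lt ltNge nrm_ge0/= => x0.
rewrite -ler_pdivrMr//; apply: lb_le_inf; first by have [] := opnorm_has_inf m.
by move=> c [_ mc]; rewrite ler_pdivrMr.
Qed.

Lemma ler_opnormD m m' : opnorm (m + m') <= opnorm m + opnorm m'.
Proof.
apply: opnorm_le => [|x]; first by rewrite addr_ge0 ?opnorm_ge0.
by rewrite (le_trans (ler_nrmD _ _))// mulrDl lerD// opnormP.
Qed.

Lemma opnorm_eq0 m : opnorm m = 0 -> m = 0.
Proof.
move=> m0; apply: mult_inj => x; apply: nrm_eq0; apply/eqP.
by rewrite eq_le nrm_ge0 andbT (le_trans (opnormP m x))// m0 mul0r.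
Qed.

Lemma opnormZ (a : R[i]) m : opnorm (a *: m) = complex.Re `|a| * opnorm m.
Proof.
have leZ : opnorm (a *: m) <= complex.Re `|a| * opnorm m.
  apply: opnorm_le => [|x]; first by rewrite mulr_ge0 ?opnorm_ge0 ?Re_norm_ge0.
  by rewrite [_ x]/(a *: m x) nrmZ -mulrA ler_wpM2l ?Re_norm_ge0// opnormP.
apply/le_anti/andP; split=> //.
have [-> | a0] := eqVneq a 0; first by rewrite normr0 mul0r opnorm_ge0.
have a0' : 0 < complex.Re `|a| by rewrite -ltcR Re_normE normr_gt0.
rewrite mulrC -ler_pdivlMr//; apply: opnorm_le => [|x].
  by rewrite divr_ge0 ?opnorm_ge0 ?Re_norm_ge0.
by rewrite mulrAC ler_pdivlMr// mulrC -nrmZ (opnormP (a *: m)).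
Qed.

End OperatorNorm.

(** * Adjoints and completeness of the multipliers *)

Section MultiplierNormed.
Variables (R : realType) (A : cstarAlgebra R).
Implicit Types (m : multiplier A).

Let mnorm m : R[i] := (opnorm m)%:C%C.

Let ler_mnormD m m' : mnorm (m + m') <= mnorm m + mnorm m'.
Proof. by rewrite /mnorm -rmorphD/= lecR ler_opnormD. Qed.

Let mnormZ (a : R[i]) m : mnorm (a *: m) = `|a| * mnorm m.
Proof. by rewrite /mnorm opnormZ -[`|a|]Re_normE -rmorphM. Qed.

Let mnorm_eq0 m : mnorm m = 0 -> m = 0.
Proof. by move=> /complexI; exact: opnorm_eq0. Qed.

HB.instance Definition _ :=
  Lmodule_isNormed.Build R[i] (multiplier A) ler_mnormD mnormZ mnorm_eq0.

Let mstar_subproof m : exists g : multiplier A, adjoint m g.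
Proof.
have [[g mg] [c mc]] := (mult_adjoint m, mult_bounded m).
have gP : g \in @adjointable R A.
  apply/adjointableP; split; first by exists m; exact: adjoint_sym.
  by exists c; exact: bounded_by_adjoint mg mc.
by exists (Multiplier gP).
Qed.

Definition mstar m : multiplier A := projT1 (cid (mstar_subproof m)).

Lemma mstarP m : adjoint m (mstar m).
Proof. exact: projT2 (cid (mstar_subproof m)). Qed.

Lemma mstarE m (g : multiplier A) : adjoint m g -> mstar m = g.
Proof.
move=> mg; apply: mult_inj => x; congr (_ x).
exact: adjoint_uniq (mstarP m) mg.
Qed.

Lemma mstarK m : mstar (mstar m) = m.
Proof. by apply: mstarE; apply: adjoint_sym; exact: mstarP. Qed.

Lemma mstar_antilinear (a : R[i]) m m' :
  mstar (a *: m + m') = Num.conj a *: mstar m + mstar m'.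
Proof. by apply: mstarE; apply: adjointZD; exact: mstarP. Qed.

Lemma nrm_mstar m : nrm (mstar m) = nrm m.
Proof.
suff le_star m' : nrm (mstar m') <= nrm m'.
  by apply: le_anti; rewrite le_star -{1}[m]mstarK le_star.
apply: opnorm_le; first exact: opnorm_ge0.
exact: bounded_by_adjoint (mstarP m') (opnormP m').
Qed.

(** Pointwise limits exist by completeness of [A], and the Cauchy estimates make the convergence
    uniform on bounded sets. The limit is a bare function here: its adjoint will come from the limit
    of the adjoints. *)
Lemma mult_limit (F : set_system (multiplier A)) (FF : ProperFilter F) :
  cauchy F -> exists l : A -> A, forall e : R, 0 < e ->
    \forall m \near F, bounded_by e (fun x => l x - mult_fun m x).
Proof.
move=> /cauchy_nrmP FC.
have lim_at x : exists y : A, (fun m : multiplier A => m x) @ F --> y.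
  suff : cauchy ((fun m : multiplier A => m x) @ F).
    by move=> /cauchy_cvg/cvg_ex.
  apply/cauchy_nrmP => e e0.
  have x1 : 0 < nrm x + 1 by rewrite ltr_wpDl ?nrm_ge0.
  have [|m0 Fm] := FC (e / (nrm x + 1)); first exact: divr_gt0.
  exists (m0 x); apply: filterS Fm => m mm.
  apply: le_lt_trans (opnormP (m0 - m) x) _.
  rewrite ltr_pdivlMr// in mm; apply: le_lt_trans mm.
  by rewrite ler_wpM2l ?opnorm_ge0// lerDl.
have [l lF] := choice lim_at; exists l => e e0.
have e20 : 0 < e / 2 by exact: divr_gt0.
have [m0 Fm] := FC _ e20.
have lm0 x : nrm (l x - m0 x) <= e / 2 * nrm x.
  apply/ler_addgt0Pr => d d0.
  (* An [m] that is both near [m0] in norm and near [l] at [x] passes the Cauchy bound to the limit,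
     up to [d]. *)
  have /cvg_nrmP/(_ d d0) Fd := lF x.
  have [m [/= m0m lm]] := filter_ex (filterI Fm Fd).
  rewrite [leRHS]addrC (le_trans (ler_nrm_dist _ (m x) _))// lerD ?(ltW lm)//.
  rewrite nrmB; apply: le_trans (opnormP (m0 - m) x) _.
  by rewrite ler_wpM2r ?nrm_ge0// ltW.
apply: filterS Fm => m m0m x; rewrite (le_trans (ler_nrm_dist _ (m0 x) _))//.
rewrite [in leRHS](splitr e) mulrDl lerD//.
apply: le_trans (opnormP (m0 - m) x) _.
by rewrite ler_wpM2r ?nrm_ge0// ltW.
Qed.

Lemma multiplier_complete (F : set_system (multiplier A)) :
  ProperFilter F -> cauchy F -> cvg F.
Proof.
move=> FF FC; have [l Fl] := mult_limit FF FC.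
(* Taking adjoints is isometric, so the adjoints converge as well; their limit [l'] is the adjoint
   of [l]. *)
have F'C : cauchy (mstar @ F).
  apply/cauchy_nrmP => e e0; have [m0 Fm] := (cauchy_nrmP FF).1 FC e e0.
  exists (mstar m0); apply: filterS Fm => m /=.
  suff -> : mstar m0 - mstar m = mstar (m0 - m) by rewrite nrm_mstar.
  rewrite [m0 - m]addrC -(scaleN1r m) mstar_antilinear rmorphN rmorph1.
  by rewrite scaleN1r addrC.
have [l' Fl'] := mult_limit _ F'C.
have ll' : adjoint l l'.
  move=> x y; apply/subr0_eq/nrm_eq0/eqP.
  rewrite eq_le nrm_ge0 andbT; apply/ler_addgt0Pr => e e0; rewrite add0r.
  have c1 : 0 < nrm x * nrm y + 1 by rewrite ltr_wpDl// mulr_ge0 ?nrm_ge0.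
  have d0 : 0 < e / 2 / (nrm x * nrm y + 1) by rewrite !divr_gt0.
  have [m [/= /(_ x) lm /(_ y) lm']] := filter_ex (filterI (Fl _ d0) (Fl' _ d0)).
  (* The contributions of [m] and [mstar m] cancel, leaving two errors of at most [e / 2] each. *)
  have -> : cmul (cstar (l x)) y - cmul (cstar x) (l' y) =
      cmul (cstar (l x - m x)) y - cmul (cstar x) (l' y - mstar m y).
    by rewrite cstarB cmulBl cmulBr -mstarP opprB addrA subrK.
  rewrite (splitr e) (le_trans (ler_nrmD _ _))// nrmN.
  have le2 (t : R) : t <= e / 2 / (nrm x * nrm y + 1) * (nrm x * nrm y) ->
      t <= e / 2.
    move=> /le_trans; apply; rewrite mulrAC ler_pdivrMr// ler_wpM2l ?lerDl//.
    by rewrite ltW// divr_gt0.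
  rewrite lerD//; apply: le2; rewrite (le_trans (nrm_cmul _ _))// nrm_cstar.
    by rewrite mulrA ler_wpM2r ?nrm_ge0.
  by rewrite [in leRHS]mulrCA ler_wpM2l ?nrm_ge0.
have lb : exists c, bounded_by c l.
  have /filter_ex[m /= lm] := Fl 1 ltr01; exists (1 + opnorm m) => x.
  rewrite -[l x](subrK (m x)) (le_trans (ler_nrmD _ _))// mulrDl lerD//.
  exact: opnormP.
have lP : l \in @adjointable R A by apply/adjointableP; split=> //; exists l'.
apply/cvg_ex; exists (Multiplier lP); apply/cvg_nrmP => e e0.
have e20 : 0 < e / 2 by exact: divr_gt0.
(* [bounded_by] is not strict, hence the passage through [e / 2]. *)
apply: filterS (Fl _ e20) => m lm; rewrite (@le_lt_trans _ _ (e / 2))//.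
  by apply: opnorm_le; [exact: ltW|].
by rewrite ltr_pdivrMr// ltr_pMr// ltr1n.
Qed.

HB.instance Definition _ :=
  Uniform_isComplete.Build (multiplier A) multiplier_complete.

End MultiplierNormed.

(** * The multiplier C*-algebra and the embedding of [A] *)

Section MultiplierAlgebra.
Variables (R : realType) (A : cstarAlgebra R).
Implicit Types (m : multiplier A) (x : A).

Let mmul_subproof m m' : m \o m' \in @adjointable R A.
Proof.
apply/adjointableP; split.
  by exists (mstar m' \o mstar m); apply: adjoint_comp; exact: mstarP.
exists (opnorm m * opnorm m') => x; rewrite (le_trans (opnormP m _))// -mulrA.
by rewrite ler_wpM2l ?opnorm_ge0// opnormP.
Qed.

Definition mmul m m' : multiplier A := Multiplier (mmul_subproof m m').

Let mone_subproof : id \in @adjointable R A.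
Proof.
apply/adjointableP; split; first by exists id; exact: adjoint_id.
by exists 1 => x; rewrite mul1r.
Qed.

Definition mone : multiplier A := Multiplier mone_subproof.

Let mmulA m m' m'' : mmul m (mmul m' m'') = mmul (mmul m m') m''.
Proof. exact: mult_inj. Qed.

Let mmul_linearl (a : R[i]) m m' m'' :
  mmul (a *: m + m') m'' = a *: mmul m m'' + mmul m' m''.
Proof. exact: mult_inj. Qed.

Let mmul_linearr (a : R[i]) m m' m'' :
  mmul m (a *: m' + m'') = a *: mmul m m' + mmul m m''.
Proof. by apply: mult_inj => x; exact: (adjoint_linear (mstarP m)). Qed.

Let mstarM m m' : mstar (mmul m m') = mmul (mstar m') (mstar m).
Proof. by apply: mstarE; apply: adjoint_comp; exact: mstarP. Qed.

Let ler_nrm_mmul m m' : nrm (mmul m m') <= nrm m * nrm m'.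
Proof.
apply: opnorm_le => [|x]; first by rewrite mulr_ge0 ?opnorm_ge0.
rewrite (le_trans (opnormP m _))// -mulrA ler_wpM2l ?opnorm_ge0//.
exact: opnormP.
Qed.

Let mnormM m m' : `|mmul m m'| <= `|m| * `|m'|.
Proof. by rewrite !nrmE -rmorphM lecR ler_nrm_mmul. Qed.

Let mnorm_star m : `|mmul (mstar m) m| = `|m| ^+ 2.
Proof.
rewrite !nrmE -rmorphXn; congr (_%:C%C); apply/eqP; rewrite eq_le.
rewrite expr2 (le_trans (ler_nrm_mmul _ _)) ?nrm_mstar//= -expr2.
(* From [|m x|^2 = |x* (m* m x)| <= c |x|^2], the square root of [c] bounds [m]. *)
set c := nrm (mmul (mstar m) m); have c0 : 0 <= c by exact: nrm_ge0.
rewrite -[leRHS]sqr_sqrtr// ler_pXn2r ?nnegrE ?nrm_ge0 ?sqrtr_ge0//.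
apply: opnorm_le => [|x]; first exact: sqrtr_ge0.
rewrite -(@ler_pXn2r _ 2)// ?nnegrE ?mulr_ge0 ?nrm_ge0 ?sqrtr_ge0//.
rewrite exprMn sqr_sqrtr// -nrm_cstar_mul mstarP (le_trans (nrm_cmul _ _))//.
rewrite nrm_cstar mulrC expr2 mulrA ler_wpM2r ?nrm_ge0//.
exact: (opnormP (mmul (mstar m) m)).
Qed.

Definition multiplierAlgebra : cstarAlgebra R :=
  @CStarAlgebra R (multiplier A) mmul (@mstar R A) mmulA mmul_linearl
    mmul_linearr (@mstarK R A) (@mstar_antilinear R A) mstarM mnormM mnorm_star.

Lemma multiplierAlgebra_unital : unital multiplierAlgebra.
Proof. by exists mone => m; split; exact: mult_inj. Qed.

Let lmult_adjoint x : adjoint (cmul x) (cmul (cstar x)).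
Proof. by move=> y z; rewrite cstarM cmulA. Qed.

Let lmult_subproof x : cmul x \in @adjointable R A.
Proof.
apply/adjointableP; split; first by exists (cmul (cstar x)).
by exists (nrm x) => y; exact: nrm_cmul.
Qed.

Definition lmult x : multiplierAlgebra := Multiplier (lmult_subproof x).

Lemma lmult_star_hom : star_hom lmult.
Proof.
split.
- by move=> a x y; apply: mult_inj => z; exact: cmul_linearl.
- by move=> x y; apply: mult_inj => z; rewrite /= cmulA.
- by move=> x; apply/esym/mstarE; exact: lmult_adjoint.
Qed.

(** For the lower bound, evaluate at the adjoint of [x]: [|x|^2 = |x x*| <= |lmult x| |x|]. *)
Lemma nrm_lmult x : nrm (lmult x) = nrm x.
Proof.
apply: le_anti; rewrite (star_hom_nrm x lmult_star_hom)/=.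
have [-> |] := eqVneq (nrm x) 0; first exact: nrm_ge0.
rewrite neq_lt ltNge nrm_ge0/= => x0.
rewrite -(ler_pM2r x0) -expr2 -(nrm_cstar x) -nrm_cstar_mul cstarK.
exact: (opnormP (lmult x)).
Qed.

Lemma nrm_lmultB x y : nrm (lmult x - lmult y) = nrm (x - y).
Proof.
have [lin _ _] := lmult_star_hom; rewrite -nrm_lmult; congr nrm.
by have := lin (-1) y x; rewrite !scaleN1r ![- _ + _]addrC.
Qed.

Lemma lmult_inj : injective lmult.
Proof.
by move=> x y xy; apply/subr0_eq/nrm_eq0; rewrite -nrm_lmultB xy subrr nrm0.
Qed.

End MultiplierAlgebra.

(** * Generated subalgebras and representations *)

Section StarHomTheory.
Variable R : realType.
Implicit Types A B C : cstarAlgebra R.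

Lemma star_hom0 A B (f : A -> B) : star_hom f -> f 0 = 0.
Proof.
by move=> [flin _ _]; have := flin (-1) 0 0; rewrite !scaleN1r !addNr.
Qed.

Lemma star_hom_id A : star_hom (@id A).
Proof. by []. Qed.

Lemma star_hom_cst0 A B : star_hom (fun _ : A => 0 : B).
Proof.
split=> [a x y|x y|x]; first by rewrite scaler0 addr0.
  by rewrite cmul0l.
by rewrite cstar0.
Qed.

Lemma star_hom_comp A B C (g : B -> C) (f : A -> B) :
  star_hom g -> star_hom f -> star_hom (g \o f).
Proof.
move=> [gl gM gs] [fl fM fs]; split=> [a x y|x y|x] /=.
- by rewrite fl gl.
- by rewrite fM gM.
- by rewrite fs gs.
Qed.

Lemma cstar_gen_subalg A (X : set A) : closed_star_subalg (cstar_gen X).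
Proof.
split.
- by apply: closed_bigI => D [[]].
- by move=> D [[]].
- by move=> a x y xX yX D DX; have [[_ _ Dlin _ _] _] := DX; apply: Dlin;
    [exact: xX|exact: yX].
- by move=> x y xX yX D DX; have [[_ _ _ DM _] _] := DX; apply: DM;
    [exact: xX|exact: yX].
- by move=> x xX D DX; have [[_ _ _ _ Ds] _] := DX; apply: Ds; exact: xX.
Qed.

Lemma sub_cstar_gen A (X : set A) : X `<=` cstar_gen X.
Proof. by move=> x Xx D [_]; apply. Qed.

Lemma cstar_gen_min A (X D : set A) :
  closed_star_subalg D -> X `<=` D -> cstar_gen X `<=` D.
Proof. by move=> DA XD x; apply. Qed.

(** Contractivity of [f] gives the closedness of the preimage. *)
Lemma preimage_subalg A B (f : A -> B) (D : set B) :
  star_hom f -> closed_star_subalg D -> closed_star_subalg (f @^-1` D).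
Proof.
move=> fh; have [flin fM fs] := fh => -[Dc D0 Dlin DM Ds]; split=> /=.
- exact: closed_preimage_lipschitz (star_hom_lipschitz fh) Dc.
- by rewrite star_hom0.
- by move=> a x y Dx Dy; rewrite flin; exact: Dlin.
- by move=> x y Dx Dy; rewrite fM; exact: DM.
- by move=> x Dx; rewrite fs; exact: Ds.
Qed.

Lemma cstar_gen_image A B (f : A -> B) (X : set A) (D : set B) :
  star_hom f -> closed_star_subalg D -> (forall x, X x -> D (f x)) ->
  forall x, cstar_gen X x -> D (f x).
Proof.
move=> fh DA XD; apply: (@cstar_gen_min A X (f @^-1` D)) => //.
exact: preimage_subalg.
Qed.

(** The equalizer of [f] and [g] is a *-subalgebra, closed because both maps are contractive. *)
Lemma cstar_gen_eq A B (f g : A -> B) (X : set A) :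
  star_hom f -> star_hom g -> (forall x, X x -> f x = g x) ->
  forall x, cstar_gen X x -> f x = g x.
Proof.
move=> fh gh Xfg; have [flin fM fs] := fh; have [glin gM gs] := gh.
apply: (@cstar_gen_min A X [set x | f x = g x]) => //; split=> /=.
- exact: closed_eq_lipschitz (star_hom_lipschitz fh) (star_hom_lipschitz gh).
- by rewrite !star_hom0.
- by move=> a x y fgx fgy; rewrite flin glin fgx fgy.
- by move=> x y fgx fgy; rewrite fM gM fgx fgy.
- by move=> x fgx; rewrite fs gs fgx.
Qed.

Lemma range_isometric_subalg A B (f : A -> B) : star_hom f ->
  (forall x y, nrm (f x - f y) = nrm (x - y)) -> closed_star_subalg (range f).
Proof.
move=> fh fi; have [flin fM fs] := fh; split.
- exact: closed_range_isometry.
- by exists 0 => //; exact: star_hom0.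
- by move=> a _ _ [x _ <-] [y _ <-]; exists (a *: x + y); rewrite ?flin.
- by move=> _ _ [x _ <-] [y _ <-]; exists (cmul x y); rewrite ?fM.
- by move=> _ [x _ <-]; exists (cstar x); rewrite ?fs.
Qed.

End StarHomTheory.

(** * Pulling back representations and using the universal property *)

Section Representations.
Variable R : realType.
Implicit Types A B : cstarAlgebra R.

Lemma representation_comp (L : smallCat) A B (f : A -> B) (S : L -> A) :
  star_hom f -> representation S -> representation (f \o S).
Proof.
move=> fh; have [_ fM fs] := fh => -[pi mulS mul0S QQ QP PP PP0 QPP].
have Q x : initial_proj (f x) = f (initial_proj x).
  by rewrite /initial_proj -fs -fM.
have P x : final_proj (f x) = f (final_proj x).
  by rewrite /final_proj -fs -fM.
split=> [k|k l kl|k l kl|k l|k l|k l|k l kl|k l kl] /=; rewrite ?Q ?P /commuting.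
- by rewrite /partial_isometry -fs -!fM pi.
- by rewrite -fM mulS.
- by rewrite -fM mul0S// star_hom0.
- by rewrite -!fM QQ.
- by rewrite -!fM QP.
- by rewrite -!fM PP.
- by rewrite -fM PP0// star_hom0.
- by rewrite -fM QPP.
Qed.

(* A functor defined on the morphisms sent to [Some _], whose domain is a union
   of connected components and which reflects composability and common
   multiples. *)
Record partial_functor (L L' : smallCat) (F : L -> option L') : Prop :=
    PartialFunctor {
  pfun_dom : forall f g, composable f g -> F f = None <-> F g = None;
  pfun_dom_comp : forall f g, composable f g -> F f = None ->
    F (Defs.comp f g) = None;
  pfun_comp : forall f g f' g', F f = Some f' -> F g = Some g' ->
    composable f g -> composable f' g' /\ F (Defs.comp f g) = Some (Defs.comp f' g');
  pfun_composable : forall f g f' g', F f = Some f' -> F g = Some g' ->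
    composable f' g' -> composable f g;
  pfun_intersect : forall f g f' g', F f = Some f' -> F g = Some g' ->
    intersect f' g' -> intersect f g
}.

(** Since [F] is defined on both or on neither of two composable morphisms, the value zero is
    consistent with all relations. Reflecting composability gives [rep_mul0], and reflecting common
    multiples gives [rep_disjoint]. *)
Lemma representation_partial_functor (L L' : smallCat) (F : L -> option L')
    A (S : L' -> A) : partial_functor F -> representation S ->
  representation (fun f => oapp S 0 (F f)).
Proof.
move=> [Fdom Fdomc Fcomp Fcmp Fint] [pi mulS mul0S QQ QP PP PP0 QPP].
have Q0 : initial_proj (0 : A) = 0 by rewrite /initial_proj cmul0r.
have P0 : final_proj (0 : A) = 0 by rewrite /final_proj cmul0l.
split=> [k|k l kl|k l kl|k l|k l|k l|k l kl|k l kl]; rewrite /commuting;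
  case Fk: (F k) => [k'|] /=; try (case Fl: (F l) => [l'|] /=);
  rewrite ?Q0 ?P0 ?cmul0l ?cmul0r//.
- by rewrite /partial_isometry !cmul0r.
- have [kl' ->] := Fcomp _ _ _ _ Fk Fl kl; exact: mulS.
- by have := (Fdom _ _ kl).2 Fl; rewrite Fk.
- by rewrite Fdomc.
- by rewrite Fdomc.
- by apply: mul0S => kl'; apply: kl; exact: Fcmp Fk Fl kl'.
- exact: QQ.
- exact: QP.
- exact: PP.
- by apply: PP0 => kl'; apply: kl; exact: Fint Fk Fl kl'.
- by apply: QPP; have [] := Fcomp _ _ _ _ Fk Fl kl.
- by have := (Fdom _ _ kl).1 Fk; rewrite Fl.
Qed.

(* The universal property is about unital algebras, so the representation is
   first pushed into the multiplier algebra of [B]. *)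
Lemma cstar_of_cat_lift (L : smallCat) A (S : L -> A) B (T : L -> B) :
  is_cstar_of_cat S -> representation T ->
  exists p : A -> B, star_hom p /\ forall f, p (S f) = T f.
Proof.
move=> [_ genS univS] repT; have lh := lmult_star_hom B.
have [p0 [[p0h p0S] _]] := univS _ (multiplierAlgebra_unital B) _
  (representation_comp lh repT).
(* As [lmult] is isometric, its range is a closed *-subalgebra. It contains the images of the
   generators, so [p0] factors through [lmult]. *)
have p0B x : range (@lmult R B) (p0 x).
  have : cstar_gen (range S) x by rewrite genS.
  apply: cstar_gen_image => //.
    exact: range_isometric_subalg (@nrm_lmultB R B).
  by move=> _ [f _ <-]; rewrite p0S; exists (T f).
have lp x : exists y, lmult y = p0 x by have [y _ <-] := p0B x; exists y.
have [p pE] := choice lp.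
have [p0lin p0M p0s] := p0h; have [llin lM ls] := lh.
exists p; split=> [|f]; last by apply: lmult_inj; rewrite pE p0S.
split=> [a x y|x y|x]; apply: lmult_inj; rewrite pE.
- by rewrite llin !pE p0lin.
- by rewrite lM !pE p0M.
- by rewrite ls pE p0s.
Qed.

Lemma cstar_of_cat_hom_eq (L : smallCat) A (S : L -> A) B (p q : A -> B) :
  is_cstar_of_cat S -> star_hom p -> star_hom q ->
  (forall f, p (S f) = q (S f)) -> forall x, p x = q x.
Proof.
move=> [_ genS _] ph qh pq x.
have : cstar_gen (range S) x by rewrite genS.
by apply: cstar_gen_eq => // _ [f _ <-].
Qed.

End Representations.

(** * Fibers of a regular action *)

Section Fiber.
Variables (G H : smallCat) (phi : H -> G).
Hypothesis Hreg : regular phi.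

Lemma fiberP g h : fiber phi g h <-> src g = phi (tgt h).
Proof. by split=> [[]//|gh]; split; rewrite ?Hreg. Qed.

Lemma fiber_composable g f h : composable f h -> fiber phi g f <-> fiber phi g h.
Proof. by move=> fh; rewrite !fiberP -fh Hreg. Qed.

Lemma fiber_comp g f h : composable f h ->
  fiber phi g (Defs.comp f h) <-> fiber phi g f.
Proof. by move=> fh; rewrite !fiberP tgt_comp. Qed.

Lemma val_fiber_comp g (f h : fiber_cat phi g) : composable f h ->
  val (Defs.comp f h) = Defs.comp (val f) (val h).
Proof.
move=> fh; rewrite /= /sub_comp; case: pselect => //= -[].
exact: subcat_comp (fiber_is_subcat phi g) _ _ (set_mem (valP f))
  (set_mem (valP h)) (congr1 val fh).
Qed.

Definition in_fiber g h (gh : fiber phi g h) : fiber_cat phi g :=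
  exist _ h (mem_set gh).

(** If a common multiple exists in [H], its cofactors are composable with [f] and [h], hence lie in
    the same fiber by regularity. *)
Lemma fiber_intersect g (f h : fiber_cat phi g) :
  intersect (val f) (val h) <-> intersect f h.
Proof.
split=> [[k [l [fk hl fkhl]]]|[k [l [fk hl fkhl]]]]; last first.
  exists (val k), (val l); split; [exact: (congr1 val fk)|exact: (congr1 val hl)|].
  by rewrite -!val_fiber_comp// fkhl.
have gk := (fiber_composable g fk).1 (set_mem (valP f)).
have gl := (fiber_composable g hl).1 (set_mem (valP h)).
have fk' : composable f (in_fiber gk) by exact: val_inj.
have hl' : composable h (in_fiber gl) by exact: val_inj.
exists (in_fiber gk), (in_fiber gl); split=> //.
by apply: val_inj; rewrite !val_fiber_comp.
Qed.

Lemma fiber_inclusion_partial_functor g :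
  partial_functor (fun h : fiber_cat phi g => Some (val h)).
Proof.
split=> // [f h _ _ [<-] [<-] fh|f h _ _ [<-] [<-] fh|f h _ _ [<-] [<-]].
- by split; [exact: (congr1 val fh)|rewrite val_fiber_comp].
- exact: val_inj.
- by move/fiber_intersect.
Qed.

Definition fiber_restrict g (h : H) : option (fiber_cat phi g) :=
  if pselect (fiber phi g h) is left gh then Some (in_fiber gh) else None.

Lemma fiber_restrict_val g (h : fiber_cat phi g) : fiber_restrict g (val h) = Some h.
Proof.
rewrite /fiber_restrict; case: pselect => [gh|[]]; last exact: set_mem (valP h).
by congr Some; exact: val_inj.
Qed.

Lemma fiber_restrict_some g h h' : fiber_restrict g h = Some h' -> val h' = h.
Proof. by rewrite /fiber_restrict; case: pselect => //= gh [<-]. Qed.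

Lemma fiber_restrict_none g h : fiber_restrict g h = None <-> ~ fiber phi g h.
Proof. by rewrite /fiber_restrict; case: pselect. Qed.

Lemma fiber_restrict_partial_functor g : partial_functor (fiber_restrict g).
Proof.
split=> [f h fh|f h fh|f h f' h' Ff Fh fh|f h f' h' Ff Fh fh|f h f' h' Ff Fh].
- by rewrite !fiber_restrict_none (fiber_composable g fh).
- by rewrite !fiber_restrict_none fiber_comp.
- have fh' : composable f' h'.
    by apply: val_inj; rewrite /= (fiber_restrict_some Ff) (fiber_restrict_some Fh).
  split=> //; rewrite -fiber_restrict_val val_fiber_comp//.
  by rewrite (fiber_restrict_some Ff) (fiber_restrict_some Fh).
- by rewrite -(fiber_restrict_some Ff) -(fiber_restrict_some Fh); exact: (congr1 val fh).
- by rewrite -(fiber_restrict_some Ff) -(fiber_restrict_some Fh) fiber_intersect.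
Qed.

Lemma fiber_cstar_iso (R : realType) (A C : cstarAlgebra R) (S : H -> A) g
    (T : fiber_cat phi g -> C) : is_cstar_of_cat S -> is_cstar_of_cat T ->
  exists p : C -> A,
    star_iso_on [set: C] (cstar_gen (S @` fiber phi g)) p /\
    forall h : fiber_cat phi g, p (T h) = S (val h).
Proof.
move=> univS univT; have [[repS _ _] [repT genT _]] := (univS, univT).
have [p [ph pT]] := cstar_of_cat_lift univT
  (representation_partial_functor (fiber_inclusion_partial_functor g) repS).
have [q [qh qS]] := cstar_of_cat_lift univS
  (representation_partial_functor (fiber_restrict_partial_functor g) repT).
have qp c : q (p c) = c.
  apply: (cstar_of_cat_hom_eq univT (star_hom_comp qh ph) (@star_hom_id _ C)).
  by move=> h /=; rewrite pT qS fiber_restrict_val.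
(* Both [p] and its left inverse [q] are contractive. *)
have p_iso x y : nrm (p x - p y) = nrm (x - y).
  apply: le_anti; rewrite -{1}[nrm (x - y)]mul1r star_hom_lipschitz//=.
  by rewrite -{1}[x]qp -{1}[y]qp -[leRHS]mul1r star_hom_lipschitz.
exists p; split=> //; split=> //; split=> [c _|x y _ _ pxy|a].
- have : cstar_gen (range T) c by rewrite genT.
  apply: cstar_gen_image => //; first exact: cstar_gen_subalg.
  move=> _ [h _ <-]; rewrite pT; apply: sub_cstar_gen.
  by exists (val h) => //; exact: set_mem (valP h).
- by rewrite -[x]qp pxy qp.
(* Surjectivity: the range of [p] is a closed *-subalgebra containing the generators. *)
- apply: cstar_gen_min; first exact: range_isometric_subalg.
  by move=> _ [h gh <-]; exists (T (in_fiber gh)); rewrite // pT.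
Qed.

End Fiber.

(** * Transport of morphisms along the action *)

Section Action.
Variables (G H : smallCat) (phi : H -> G) (alpha : G -> H -> H).
Hypotheses (HG : is_groupoid G) (Halpha : is_action phi alpha).
Hypothesis Hreg : regular phi.
Implicit Types (g : G) (f h : H).

Let fiber_dom g h : fiber phi g h -> act_dom phi g h.
Proof. by case. Qed.

Lemma act_fiber g h : fiber phi g h -> fiber phi (tgt g) (alpha g h).
Proof.
move=> gh; apply/(fiberP Hreg); rewrite src_tgt.
have [gsh gth] := gh.
rewrite -(act_tgt Halpha)// (act_phi Halpha) ?/objects /= ?src_tgt//.
by split; rewrite ?tgt_tgt ?src_tgt.
Qed.

Lemma act_composable g f h : fiber phi g f -> fiber phi g h -> composable f h ->
  composable (alpha g f) (alpha g h).
Proof.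
move=> gf gh fh; rewrite /composable -(act_src Halpha) ?fh ?(act_tgt Halpha)//;
  exact: fiber_dom.
Qed.

Lemma act_inverse g k h : composable k g -> Defs.comp k g = src g ->
  fiber phi g h -> alpha k (alpha g h) = h.
Proof.
move=> kg kgE gh; have gh' := fiber_dom gh; have [_ ghE] := gh.
by rewrite (act_comp Halpha)// kgE ghE (act_id Halpha gh').
Qed.

Lemma fiber_tgt_of_inverse g k h : composable k g ->
  fiber phi (tgt g) h -> fiber phi k h.
Proof. by move=> kg; rewrite !(fiberP Hreg) src_tgt kg. Qed.

Definition act_partial g h : option H :=
  if pselect (fiber phi g h) is left _ then Some (alpha g h) else None.

Lemma act_partial_in g h : fiber phi g h -> act_partial g h = Some (alpha g h).
Proof. by rewrite /act_partial; case: pselect. Qed.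

Lemma act_partial_some g h h' : act_partial g h = Some h' ->
  fiber phi g h /\ h' = alpha g h.
Proof. by rewrite /act_partial; case: pselect => // gh [<-]. Qed.

Lemma act_partial_none g h : act_partial g h = None <-> ~ fiber phi g h.
Proof. by rewrite /act_partial; case: pselect. Qed.

(** Acting by the inverse [k] of [g] undoes [alpha g] on the fiber, so composability and common
    multiples are reflected; cofactors [l], [m] pull back to [alpha k l], [alpha k m]. *)
Lemma act_partial_functor g : partial_functor (act_partial g).
Proof.
have [k [gk kg gkE kgE]] := HG g.
have inv h : fiber phi g h -> alpha k (alpha g h) = h.
  by move=> gh; rewrite act_inverse.
have kfib h : fiber phi g h -> fiber phi k (alpha g h).
  by move=> gh; apply: fiber_tgt_of_inverse kg (act_fiber gh).
split=> [f h fh|f h fh|f h f' h'|f h f' h'|f h f' h'].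
- by rewrite !act_partial_none (fiber_composable Hreg g fh).
- by rewrite !act_partial_none (fiber_comp Hreg).
- move=> /act_partial_some[gf ->] /act_partial_some[gh ->] fh.
  split; first exact: act_composable.
  rewrite act_partial_in ?(act_mul Halpha)//; try exact: fiber_dom.
  exact/(fiber_comp Hreg).
- move=> /act_partial_some[gf ->] /act_partial_some[gh ->] fh.
  by rewrite -[f]inv// -[h]inv//; apply: act_composable => //; exact: kfib.
- move=> /act_partial_some[gf ->] /act_partial_some[gh ->] [l [m [fl hm flhm]]].
  have kl := (fiber_composable Hreg k fl).1 (kfib _ gf).
  have km := (fiber_composable Hreg k hm).1 (kfib _ gh).
  have [kf kh] := (kfib _ gf, kfib _ gh).
  have fl' : composable f (alpha k l) by rewrite -[f]inv//; exact: act_composable.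
  have hm' : composable h (alpha k m) by rewrite -[h]inv//; exact: act_composable.
  exists (alpha k l), (alpha k m); split=> //.
  rewrite -{1}[f]inv// -{1}[h]inv// -!(act_mul Halpha) ?flhm//;
    exact: fiber_dom.
Qed.

End Action.

(** * The quasi action *)

Section QuasiAction.
Variables (R : realType) (G H : smallCat) (phi : H -> G) (alpha : G -> H -> H).
Hypotheses (HG : is_groupoid G) (Halpha : is_action phi alpha).
Hypothesis Hreg : regular phi.
Variables (A : cstarAlgebra R) (S : H -> A).
Hypothesis univS : is_cstar_of_cat S.
Implicit Types (g k u : G) (h : H) (x y : A).

Let E u := cstar_gen (S @` fiber phi u).

Let fiber_srcE g : fiber phi (src g) = fiber phi g.
Proof. by rewrite /fiber src_src. Qed.

(** Killing the generators outside the fiber yields a map on all of [A], as a quasi action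
    requires. *)
Let lift_ex g : exists b : A -> A, star_hom b /\
  forall h, b (S h) = oapp S 0 (act_partial phi alpha g h).
Proof.
apply: cstar_of_cat_lift => //; apply: representation_partial_functor.
  exact: act_partial_functor.
by case: univS.
Qed.

Definition act_star_hom g : A -> A := projT1 (cid (lift_ex g)).

Local Notation b := act_star_hom.

Lemma act_star_homP g : star_hom (b g).
Proof. by rewrite /b; case: cid => p []. Qed.

Let bS g h : b g (S h) = oapp S 0 (act_partial phi alpha g h).
Proof. by rewrite /b; case: cid => p []. Qed.

Lemma act_star_hom_in g h : fiber phi g h -> b g (S h) = S (alpha g h).
Proof. by move=> gh; rewrite bS act_partial_in. Qed.

Lemma act_star_hom_out g h : ~ fiber phi g h -> b g (S h) = 0.
Proof. by move=> gh; rewrite bS (act_partial_none _ _ _ _).2. Qed.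

Lemma act_star_hom_sub g x : E (tgt g) (b g x).
Proof.
have [_ genS _] := univS; have : cstar_gen (range S) x by rewrite genS.
apply: cstar_gen_image; [exact: act_star_homP|exact: cstar_gen_subalg|].
move=> _ [h _ <-]; have [gh|gh] := pselect (fiber phi g h).
  rewrite act_star_hom_in//; apply: sub_cstar_gen; exists (alpha g h) => //.
  exact: act_fiber.
by rewrite act_star_hom_out//; apply: subalg_zero; exact: cstar_gen_subalg.
Qed.

Lemma act_star_hom_comp s t x : composable s t ->
  b (Defs.comp s t) x = b s (b t x).
Proof.
move=> st; apply: (cstar_of_cat_hom_eq (q := b s \o b t) univS) => [||h].
- exact: act_star_homP.
- exact: star_hom_comp (act_star_homP s) (act_star_homP t).
rewrite [RHS]/=; have stE : fiber phi (Defs.comp s t) h <-> fiber phi t h.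
  by rewrite !(fiberP Hreg) src_comp.
have [th|th] := pselect (fiber phi t h); last first.
  rewrite (act_star_hom_out th) star_hom0 ?act_star_hom_out// ?stE//.
  exact: act_star_homP.
(* The morphism [alpha t h] lies in the fiber of [tgt t = src s], which is the fiber of [s]. *)
rewrite !act_star_hom_in ?stE//; last first.
  by have := act_fiber Halpha Hreg th; rewrite -st fiber_srcE.
by rewrite -(act_comp Halpha)//; case: th.
Qed.

(** On generators: [b t] lands in the fiber of [tgt t], which [b s] kills when [tgt t] differs from
    [src s]. *)
Lemma act_star_hom_zero s t x : ~ composable s t -> b s (b t x) = 0.
Proof.
move=> st.
apply: (cstar_of_cat_hom_eq (p := b s \o b t) (q := fun=> 0) univS) => [||h].
- exact: star_hom_comp (act_star_homP s) (act_star_homP t).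
- exact: star_hom_cst0.
have s0 := star_hom0 (act_star_homP s); rewrite [LHS]/=.
have [th|th] := pselect (fiber phi t h); last by rewrite (act_star_hom_out th).
rewrite (act_star_hom_in th) act_star_hom_out// => sh.
apply: st; rewrite /composable ((fiberP Hreg _ _).1 sh).
by rewrite -((fiberP Hreg _ _).1 (act_fiber Halpha Hreg th)) src_tgt.
Qed.

Lemma act_star_hom_id u x : src u = u -> E u x -> b u x = x.
Proof.
move=> uE; apply: cstar_gen_eq; [exact: act_star_homP|exact: star_hom_id|].
move=> _ [h uh <-]; rewrite act_star_hom_in//; congr S; have [_ uth] := uh.
rewrite -{1}uE uth (act_id Halpha (g := u))//; case: uh => *; split=> //.
Qed.

(** For an inverse [k] of [g], [b k] is the inverse: the two composites are [b (src g)] and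
    [b (tgt g)], identities on [E (src g)] and [E (tgt g)]. *)
Lemma act_star_hom_bij g : set_bij (E (src g)) (E (tgt g)) (b g).
Proof.
have [k [gk kg gkE kgE]] := HG g; split=> [x _|x y|y yE].
- exact: act_star_hom_sub.
- rewrite !inE => xE yE bxy.
  rewrite -[x](act_star_hom_id (src_src g))// -[y](act_star_hom_id (src_src g))//.
  by rewrite -kgE !act_star_hom_comp// bxy.
- exists (b k y); first by rewrite gk; exact: act_star_hom_sub.
  by rewrite -act_star_hom_comp// gkE act_star_hom_id// src_tgt.
Qed.

Lemma range_act_star_hom g : range (b g) = E (tgt g).
Proof.
apply/seteqP; split=> [_ [x _ <-]|y]; first exact: act_star_hom_sub.
by have [_ _ /[apply]] := act_star_hom_bij g => -[x _ <-]; exists x.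
Qed.

Let act_pendo_iso g : star_iso_on (E (src g)) (range (b g)) (b g).
Proof.
split; first exact: act_star_homP.
by rewrite range_act_star_hom; exact: act_star_hom_bij.
Qed.

Definition act_pendo g : partialEndo A :=
  PartialEndo (act_star_homP g) (cstar_gen_subalg _) (act_pendo_iso g).

Lemma act_pendo_quasi_action : quasi_action act_pendo.
Proof.
split=> s t st /=.
- by rewrite range_act_star_hom st.
- by rewrite src_comp.
- by move=> x; exact: act_star_hom_comp.
- by move=> x; exact: act_star_hom_zero.
Qed.

End QuasiAction.

Theorem proposition3p2 (R : realType) (G H : smallCat)
    (phi : H -> G) (alpha : G -> H -> H)
    (HG : is_groupoid G)
    (Halpha : is_action phi alpha)
    (Hreg : regular phi)
    (A : cstarAlgebra R) (S : H -> A) (HS : is_cstar_of_cat S) :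
  (forall g : G,
     fiber phi g = fiber phi (src g) /\
     forall (C : cstarAlgebra R) (T : fiber_cat phi g -> C),
       is_cstar_of_cat T ->
       exists p : C -> A,
         star_iso_on [set: C] (cstar_gen (S @` fiber phi g)) p /\
         forall h : fiber_cat phi g, p (T h) = S (val h))
  /\
  (exists beta : G -> partialEndo A,
     quasi_dynamical_system beta /\
     forall g : G,
       star_iso_on (cstar_gen (S @` fiber phi (src g)))
                   (cstar_gen (S @` fiber phi (tgt g))) (beta g) /\
       forall h : H, fiber phi g h -> beta g (S h) = S (alpha g h)).
Proof.
split=> [g|].
  split; first by rewrite /fiber src_src.
  by move=> C T; exact: fiber_cstar_iso.
exists (act_pendo HG Halpha Hreg HS); split.
  by split=> //; exact: act_pendo_quasi_action.
move=> g; split=> [|h]; last exact: act_star_hom_in.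
by split; [exact: act_star_homP|exact: act_star_hom_bij].
Qed.
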